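(* Let $\alpha\in(0,1)$, $\mathrm{g}\ge0$, $\epsilon>0$, and let $u^0,u^1,\dots,u^N\in\mathcal{V}_h$ be the solution of the variable-step L1 scheme described in the context. If the maximum time step satisfies $$\tau \le \left(\frac{3}{\Gamma(2-\alpha)(4\mathrm{g}^2+3\epsilon)}\right)^{1/\alpha},$$ then the modified discrete energy is nonincreasing: $\mathcal{E}[u^n]-\mathcal{E}[u^{n-1}]\le 0$ (equivalently $(\mathcal{E}[u^n]-\mathcal{E}[u^{n-1}])/\tau_n\le 0$) for all $1\le n\le N$.
   Context: Time grid: $0=t_0<t_1<\dots<t_N=T$, $\tau_k=t_k-t_{k-1}$, $\tau=\max_k\tau_k$, $\triangledown_\tau v^k=v^k-v^{k-1}$. Let $\omega_{\beta}(t)=t^{\beta-1}/\Gamma(\beta)$. The L1 kernels are $a^{(n)}_{n-k}=\frac{1}{\tau_k}\int_{t_{k-1}}^{t_k}\omega_{1-\alpha}(t_n-s)\,ds$ for $1\le k\le n$, and $D^\alpha_\tau v^n=\sum_{k=1}^n a^{(n)}_{n-k}\triangledown_\tau v^k$. The discrete complementary convolution kernels are defined by $p^{(n)}_0=1/a^{(n)}_0$ and $p^{(n)}_{n-k}=\frac{1}{a^{(k)}_0}\sum_{j=k+1}^n\big(a^{(j)}_{j-k-1}-a^{(j)}_{j-k}\big)p^{(n)}_{n-j}$ for $1\le k\le n-1$. Space: $\Omega=(0,L)^2$, $h=L/M$, $x_i=ih$, $y_j=jh$; $\mathcal{V}_h$ is the set of grid functions on $\{(x_i,y_j):0\le i,j\le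 M\}$ that are $L$-periodic in each direction; $\Delta_h=\delta_x^2+\delta_y^2$ with $\delta_x^2v_{ij}=(v_{i+1,j}-2v_{ij}+v_{i-1,j})/h^2$ and similarly $\delta_y^2$. Discrete inner product $\langle v,w\rangle=h^2\sum_{1\le i,j\le M-1}v_{ij}w_{ij}$, $\|v\|=\sqrt{\langle v,v\rangle}$, $\|v\|_4^4=h^2\sum_{1\le i,j\le M-1}v_{ij}^4$. Let $f(u)=u^3-\mathrm{g}u^2-\epsilon u$. The scheme: $u^0_h=u_0(x_h)$ and for $1\le n\le N$, $D^\alpha_\tau u^n_h=-\mu^n_h$ with $\mu^n_h=(1+\Delta_h)^2u^n_h+f(u^n_h)$ at the grid points, periodic boundary conditions. Discrete energy: $E[u^n]=\frac12\|(1+\Delta_h)u^n\|^2+\frac14\|u^n\|_4^4-\frac{\mathrm g}{3}\langle (u^n)^2,u^n\rangle-\frac{\epsilon}{2}\|u^n\|^2$. Modified energy: $\mathcal{E}[u^0]=E[u^0]$ and $\mathcal{E}[u^n]=E[u^n]+\frac12\sum_{j=1}^n p^{(n)}_{n-j}\|\mu^j\|^2$ for $n\ge1$.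
   Formalization: The discrete inner product and norms are summed over one full period (i,j = 0,…,M−1) instead of 1 ≤ i,j ≤ M−1, since for periodic grid functions the sums that omit the line i = 0 or j = 0 make the energy claim false (e.g. M = 2, h² = 2, g = 0, ε = 1). *)

(* Defs.v *)
From HB Require Import structures.
From mathcomp Require Import all_boot all_order all_algebra.
From mathcomp Require Import all_classical all_reals all_analysis.
Set Implicit Arguments. Unset Strict Implicit. Unset Printing Implicit Defensive.
Import Order.TTheory GRing.Theory Num.Theory.
Local Open Scope classical_set_scope.
Local Open Scope ring_scope.

Section Defs.
Variable R : realType.

Definition Gamma (b : R) : R :=
  fine (\int[lebesgue_measure]_(x in `]0%R, +oo[) (powR x (b - 1) * expR (- x))%:E).

Definition omega (b t : R) : R := powR t (b - 1) / Gamma b.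

(* L1 kernel  a^{(n)}_{n-k} = (1/tau_k) int_{t_{k-1}}^{t_k} omega_{1-alpha}(t_n - s) ds,
   indexed here by (n, k). *)
Definition akern (alpha : R) (t : nat -> R) (n k : nat) : R :=
  (t k - t k.-1)^-1 *
  fine (\int[lebesgue_measure]_(s in `[t k.-1, t k]) (omega (1 - alpha) (t n - s))%:E).

(* Course-of-values computation of [p^{(n)}_0; ...; p^{(n)}_m]:
   p^{(n)}_0 = 1/a^{(n)}_0 and, with k = n - m,
   p^{(n)}_{n-k} = 1/a^{(k)}_0 * sum_{j=k+1}^{n} (a^{(j)}_{j-k-1} - a^{(j)}_{j-k}) p^{(n)}_{n-j}. *)
Fixpoint pseq (alpha : R) (t : nat -> R) (n m : nat) : seq R :=
  match m with
  | 0 => [:: (akern alpha t n n)^-1]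
  | m'.+1 =>
      let s := pseq alpha t n m' in
      let k := (n - m)%N in
      rcons s ((akern alpha t k k)^-1 *
               \sum_(k.+1 <= j < n.+1)
                  (akern alpha t j k.+1 - akern alpha t j k) * nth 0 s (n - j))
  end.

(* pkern n m = p^{(n)}_m  (meaningful for m <= n-1) *)
Definition pkern (alpha : R) (t : nat -> R) (n m : nat) : R :=
  nth 0 (pseq alpha t n m) m.

Definition Dalpha (alpha : R) (t : nat -> R) (u : nat -> nat -> nat -> R)
    (n i j : nat) : R :=
  \sum_(1 <= k < n.+1) akern alpha t n k * (u k i j - u k.-1 i j).

(* Grid functions: v i j = v_{ij}, L-periodic, i.e. indices taken modulo M;
   only 0 <= i, j < M (one full period) matter. *)
Definition lap (M : nat) (h : R) (v : nat -> nat -> R) (i j : nat) : R :=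
  (v ((i + 1) %% M)%N j - 2 * v i j + v ((i + M - 1) %% M)%N j) / h ^+ 2 +
  (v i ((j + 1) %% M)%N - 2 * v i j + v i ((j + M - 1) %% M)%N) / h ^+ 2.

Definition opl (M : nat) (h : R) (v : nat -> nat -> R) : nat -> nat -> R :=
  fun i j => v i j + lap M h v i j.

Definition fnl (g eps x : R) : R := x ^+ 3 - g * x ^+ 2 - eps * x.

Definition chem (g eps : R) (M : nat) (h : R) (v : nat -> nat -> R) :
    nat -> nat -> R :=
  fun i j => opl M h (opl M h v) i j + fnl g eps (v i j).

Definition ip (M : nat) (h : R) (v w : nat -> nat -> R) : R :=
  h ^+ 2 * \sum_(i < M) \sum_(j < M) v i j * w i j.

Definition nrm2 (M : nat) (h : R) (v : nat -> nat -> R) : R := ip M h v v.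

Definition nrm4_4 (M : nat) (h : R) (v : nat -> nat -> R) : R :=
  h ^+ 2 * \sum_(i < M) \sum_(j < M) v i j ^+ 4.

Definition energy (g eps : R) (M : nat) (h : R) (v : nat -> nat -> R) : R :=
  2^-1 * nrm2 M h (opl M h v) + 4^-1 * nrm4_4 M h v
  - g / 3 * ip M h (fun i j => v i j ^+ 2) v - eps / 2 * nrm2 M h v.

Definition menergy (alpha g eps : R) (t : nat -> R) (M : nat) (h : R)
    (u : nat -> nat -> nat -> R) (n : nat) : R :=
  if n is 0 then energy g eps M h (u 0%N)
  else energy g eps M h (u n) +
       2^-1 * \sum_(1 <= j < n.+1)
                 pkern alpha t n (n - j) * nrm2 M h (chem g eps M h (u j)).

Definition taumax (t : nat -> R) (N : nat) : R :=
  \big[Num.max/0]_(1 <= k < N.+1) (t k - t k.-1).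

End Defs.

(* Main.v *)
Require Import Defs.
From HB Require Import structures.
From mathcomp Require Import all_boot all_order all_algebra.
From mathcomp Require Import all_classical all_reals all_analysis.
From mathcomp Require Import measurable_realfun ring lra zify.
Import Order.TTheory GRing.Theory Num.Theory.
Import numFieldNormedType.Exports.
Local Open Scope ring_scope.

(* Put [r_j = p^(n)_(n-j) - p^(n-1)_(n-1-j)], with [r_n = p^(n)_0 = 1 / a^(n)_0].
   The complementary identity [sum_j p^(n)_(n-j) a^(j)_(j-k) = 1] makes [r]
   orthogonal to the L1 kernels and inverts the scheme:
   [u^n - u^(n-1) = - sum_j r_j mu^j].  Since the kernel [t^(-alpha)] is positive,
   decreasing and log-convex, [r_j <= 0] for [j < n] and [sum_j r_j >= 0], whence
     [2 mu^n sum_j r_j mu^j >= sum_j r_j (mu^j)^2 + a^(n)_0 (sum_j r_j mu^j)^2].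
   The energy increment is at most
   [<mu^n, u^n - u^(n-1)> + (g^2/6 + eps/2) |u^n - u^(n-1)|^2], and the step
   restriction gives [a^(n)_0 / 2 >= g^2/6 + eps/2], so the last term is absorbed. *)

(** * Discrete convolution kernels: orthogonality, signs and a quadratic inequality *)

Lemma exchange_big_triangle (V : zmodType) (n : nat) (F : nat -> nat -> V) :
  \sum_(1 <= k < n.+1) \sum_(1 <= l < k.+1) F k l =
  \sum_(1 <= l < n.+1) \sum_(l <= k < n.+1) F k l.
Proof.
elim: n => [|n IHn]; first by rewrite !big_geq.
rewrite big_nat_recr//= IHn.
transitivity (\sum_(1 <= l < n.+2) (\sum_(l <= k < n.+1) F k l + F n.+1 l)).
  rewrite big_split/=; congr (_ + _).
  by rewrite [RHS]big_nat_recr//= [X in _ + X]big_geq// addr0.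
by apply: eq_big_nat => l /andP[_ ln]; rewrite [RHS]big_nat_recr.
Qed.

(** Downward induction on [k]: the recursion for [p k] says exactly that the sums at [k] and at
    [k.+1] coincide, and at [k = n] the sum is [p n * a n n]. *)
Lemma complementary_convolution (R : realFieldType) (a : nat -> nat -> R)
    (p : nat -> R) (n : nat) :
  p n * a n n = 1 ->
  (forall k, (1 <= k < n)%N ->
     p k * a k k = \sum_(k.+1 <= j < n.+1) (a j k.+1 - a j k) * p j) ->
  forall k, (1 <= k <= n)%N -> \sum_(k <= j < n.+1) p j * a j k = 1.
Proof.
move=> pn prec k; elim: (n - k)%N {-2}k (erefl (n - k)%N) => {k} [|d IHd] k dk kn.
  by have -> : k = n by [lia]; rewrite big_nat1.
rewrite big_ltn ?prec; try lia.
rewrite -big_split/= -[RHS](IHd k.+1); try lia.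
by apply: eq_bigr => j _; ring.
Qed.

Section OrthogonalKernel.
Variables (R : realFieldType) (a : nat -> nat -> R) (r : nat -> R) (n : nat).
Hypothesis a_gt0 : forall j k, (1 <= k <= j)%N -> (j <= n)%N -> 0 < a j k.
Hypothesis rn_gt0 : 0 < r n.
Hypothesis r_orth : forall k, (1 <= k < n)%N ->
  \sum_(k <= j < n.+1) r j * a j k = 0.

(* Orthogonality at [k.+1] lets [r n * a n k] dominate the already-known
   nonpositive terms because the ratio [a j k / a j k.+1] increases with [j]. *)
Lemma orthogonal_kernel_le0 :
  (forall j k, (1 <= k < j)%N -> (j <= n)%N ->
     a j k * a n k.+1 <= a n k * a j k.+1) ->
  forall k, (1 <= k < n)%N -> r k <= 0.
Proof.
move=> a_ratio k; elim: (n - k)%N {-2}k (leqnn (n - k)%N) => {k} [|d IHd] k dk kn.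
  by lia.
have := r_orth k kn; rewrite big_ltn; last lia.
move=> /eqP; rewrite addr_eq0 => /eqP rk.
have akk : 0 < a k k by apply: a_gt0; lia.
suff S_ge0 : 0 <= \sum_(k.+1 <= j < n.+1) r j * a j k.
  by rewrite -(pmulr_lle0 _ akk) rk oppr_le0.
have [kn1|kn1] := eqVneq k.+1 n.
  by rewrite kn1 big_nat1 mulr_ge0 ?ltW ?a_gt0//; lia.
have ank1 : 0 < a n k.+1 by apply: a_gt0; lia.
rewrite -(pmulr_lge0 _ ank1).
have H0 : a n k * \sum_(k.+1 <= j < n.+1) r j * a j k.+1 = 0.
  by rewrite r_orth ?mulr0//; lia.
rewrite -[leLHS]H0 big_distrl big_distrr/=; apply: ler_sum_nat => j jn.
have [jn'|jn'] := eqVneq j n; first by rewrite jn' le_eqVlt; apply/orP; left; apply/eqP; ring.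
have rj : r j <= 0 by apply: IHd; lia.
have jk : a j k * a n k.+1 <= a n k * a j k.+1 by apply: a_ratio; lia.
by rewrite mulrCA -mulrA ler_wnM2l.
Qed.

(** In the orthogonality relation at [k = 1], replacing every [a j 1] by the smaller [a n 1] can
    only increase the sum, because [r j <= 0] for [j < n]. Hence [0 <= a n 1 * \sum_j r j]. *)
Lemma orthogonal_kernel_sum_ge0 :
  (0 < n)%N ->
  (forall k, (1 <= k < n)%N -> r k <= 0) ->
  (forall j, (1 <= j <= n)%N -> a n 1 <= a j 1) ->
  0 <= \sum_(1 <= j < n.+1) r j.
Proof.
move=> n_gt0 r_le0 a_anti.
have [n1|n1] := leqP n 1.
  by have -> : n = 1%N by [lia]; rewrite big_nat1 ltW// -(_ : n = 1%N)//; lia.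
have an1 : 0 < a n 1 by apply: a_gt0; lia.
rewrite -(pmulr_lge0 _ an1) -[leLHS](r_orth 1); last lia.
rewrite big_distrl/=; apply: ler_sum_nat => j jn.
have [->//|jn'] := eqVneq j n.
by rewrite ler_wnM2l ?r_le0 ?a_anti//; lia.
Qed.

End OrthogonalKernel.

(* Expand [0 <= \sum_(j < n) - r j * (w j - c) ^+ 2] with
   [c := (\sum_(j < n) - r j * w j) / r n]. *)
Lemma convolution_square_le (R : realFieldType) (r w : nat -> R) (n : nat) :
  (0 < n)%N -> 0 < r n -> (forall k, (1 <= k < n)%N -> r k <= 0) ->
  0 <= \sum_(1 <= j < n.+1) r j ->
  \sum_(1 <= j < n.+1) r j * w j ^+ 2
    + (r n)^-1 * (\sum_(1 <= j < n.+1) r j * w j) ^+ 2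
  <= 2 * w n * \sum_(1 <= j < n.+1) r j * w j.
Proof.
move=> n0 rn r_le0; rewrite !big_nat_recr//=.
set K := \sum_(1 <= j < n) r j; set S := \sum_(1 <= j < n) _ * w _.
set Q := \sum_(1 <= j < n) _ => K_ge.
pose c := - S / r n.
have : \sum_(1 <= j < n) r j * (w j - c) ^+ 2 <= 0.
  apply: (@le_trans _ _ (\sum_(1 <= j < n) (0:R))); last by rewrite big1.
  by apply: ler_sum_nat => j jn; rewrite mulr_le0_ge0 ?r_le0 ?sqr_ge0.
have -> : \sum_(1 <= j < n) r j * (w j - c) ^+ 2 = Q - 2 * c * S + c ^+ 2 * K.
  rewrite /Q /S /K !big_distrr/= -sumrN -!big_split/=.
  by apply: eq_bigr => j _; ring.
have -> : S = - c * r n by rewrite /c; field; rewrite gt_eqF.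
move=> H.
(* With [S = - c * r n], the bound [H] and this one give [Q <= - c ^+ 2 * r n], which is the claim
   once the squares are expanded. *)
have : 0 <= c ^+ 2 * (K + r n) by rewrite mulr_ge0 ?sqr_ge0.
have -> : (r n)^-1 * (- c * r n + r n * w n) ^+ 2 = r n * (w n - c) ^+ 2.
  by field; rewrite gt_eqF.
nra.
Qed.

(** * Summation by parts on the periodic grid and the increment of the energy *)

Lemma sum_shift (R : realFieldType) (M : nat) (F : nat -> nat -> R) :
  \sum_(i < M) F ((i + 1) %% M)%N i = \sum_(i < M) F i ((i + M - 1) %% M)%N.
Proof.
rewrite [RHS](reindex_inj (@ordS_inj M)); apply: eq_bigr => i _.
have : val (ord_pred (ordS i)) = i by rewrite ordSK.
by rewrite /= !addn1 -subn1 => ->.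
Qed.

Section Energy.
Variables (R : realType) (M : nat) (h : R).
Implicit Types v w : nat -> nat -> R.

Lemma ipE v w :
  ip M h v w = h ^+ 2 * \sum_(i < M) \sum_(j < M) v i j * w i j.
Proof. by []. Qed.

(** By periodicity the adjoint of a forward shift is the backward shift ([Ex], [Ey]), and [lap]
    weights the two equally. *)
Lemma lap_selfadjoint v w : ip M h (lap M h v) w = ip M h v (lap M h w).
Proof.
rewrite !ipE; congr (_ * _).
have Ex (F G : nat -> nat -> R) :
  \sum_(i < M) \sum_(j < M) F ((i + 1) %% M)%N j * G i j =
  \sum_(i < M) \sum_(j < M) F i j * G ((i + M - 1) %% M)%N j.
  rewrite exchange_big/= [RHS]exchange_big/=; apply: eq_bigr => j _.
  exact: (@sum_shift R M (fun i k => F i j * G k j)).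
have Ey (F G : nat -> nat -> R) :
  \sum_(i < M) \sum_(j < M) F i ((j + 1) %% M)%N * G i j =
  \sum_(i < M) \sum_(j < M) F i j * G i ((j + M - 1) %% M)%N.
  apply: eq_bigr => i _.
  exact: (@sum_shift R M (fun j k => F i j * G i k)).
have lapl (F G : nat -> nat -> R) :
  \sum_(i < M) \sum_(j < M) lap M h F i j * G i j =
  h ^- 2 * (\sum_(i < M) \sum_(j < M) F ((i + 1) %% M)%N j * G i j
   + \sum_(i < M) \sum_(j < M) F i ((j + 1) %% M)%N * G i j
   + \sum_(i < M) \sum_(j < M) G i j * F ((i + M - 1) %% M)%N j
   + \sum_(i < M) \sum_(j < M) G i j * F i ((j + M - 1) %% M)%N
   - 4 * \sum_(i < M) \sum_(j < M) F i j * G i j).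
  rewrite big_distrr/= -sumrN -!big_split big_distrr/=; apply: eq_bigr => i _.
  rewrite big_distrr/= -sumrN -!big_split big_distrr/=; apply: eq_bigr => j _.
  by rewrite /lap; ring.
under [RHS]eq_bigr do under eq_bigr do rewrite mulrC.
rewrite !lapl -!Ex -!Ey; congr (_ * _).
have -> : \sum_(i < M) \sum_(j < M) w i j * v i j = \sum_(i < M) \sum_(j < M) v i j * w i j.
  by apply: eq_bigr => i _; apply: eq_bigr => j _; rewrite mulrC.
ring.
Qed.

Lemma opl_selfadjoint v w : ip M h (opl M h v) w = ip M h v (opl M h w).
Proof.
have : ip M h (lap M h v) w = ip M h v (lap M h w) by exact: lap_selfadjoint.
rewrite !ipE => H.
have E1 : \sum_(i < M) \sum_(j < M) opl M h v i j * w i j =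
   \sum_(i < M) \sum_(j < M) v i j * w i j + \sum_(i < M) \sum_(j < M) lap M h v i j * w i j.
  rewrite -big_split; apply: eq_bigr => i _; rewrite -big_split; apply: eq_bigr => j _.
  by rewrite /opl mulrDl.
have E2 : \sum_(i < M) \sum_(j < M) v i j * opl M h w i j =
   \sum_(i < M) \sum_(j < M) v i j * w i j + \sum_(i < M) \sum_(j < M) v i j * lap M h w i j.
  rewrite -big_split; apply: eq_bigr => i _; rewrite -big_split; apply: eq_bigr => j _.
  by rewrite /opl mulrDr.
by rewrite E1 E2 !mulrDr H.
Qed.

(* The constant [g ^+ 2 / 6 + eps / 2] is [- inf f' / 2]. *)
Lemma potential_convexity (g eps x y : R) :
  4^-1 * x ^+ 4 - g / 3 * (x ^+ 2 * x) - eps / 2 * (x * x)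
  - (4^-1 * y ^+ 4 - g / 3 * (y ^+ 2 * y) - eps / 2 * (y * y))
  <= fnl g eps x * (x - y) + (g ^+ 2 / 6 + eps / 2) * (x - y) ^+ 2.
Proof.
rewrite -subr_ge0.
have -> : fnl g eps x * (x - y) + (g ^+ 2 / 6 + eps / 2) * (x - y) ^+ 2
  - (4^-1 * x ^+ 4 - g / 3 * (x ^+ 2 * x) - eps / 2 * (x * x)
  - (4^-1 * y ^+ 4 - g / 3 * (y ^+ 2 * y) - eps / 2 * (y * y)))
  = (x - y) ^+ 2 * (2^-1 * (x - g / 3) ^+ 2
     + ((x - y) / 2 - (x - g / 3)) ^+ 2).
  by rewrite /fnl; field.
by rewrite mulr_ge0 ?sqr_ge0// addr_ge0 ?sqr_ge0// mulr_ge0 ?sqr_ge0 ?invr_ge0.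
Qed.

(** The quadratic part uses [(A ^+ 2 - B ^+ 2) / 2 <= A * (A - B)] with [A], [B] the images of [v],
    [w] under [opl]; the remaining terms are bounded pointwise by [potential_convexity]. *)
Lemma energy_increment_le (g eps : R) v w :
  energy g eps M h v - energy g eps M h w <=
  h ^+ 2 * \sum_(i < M) \sum_(j < M) (chem g eps M h v i j * (v i j - w i j)
    + (g ^+ 2 / 6 + eps / 2) * (v i j - w i j) ^+ 2).
Proof.
pose d i j := v i j - w i j.
have Ld i j : opl M h d i j = opl M h v i j - opl M h w i j.
  by rewrite /opl /lap /d; ring.
(* Self-adjointness moves one of the two factors [opl] in [chem] onto the difference [d]. *)
have sa := opl_selfadjoint (opl M h v) d.
have -> : h ^+ 2 * \sum_(i < M) \sum_(j < M) (chem g eps M h v i j * (v i j - w i j)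
    + (g ^+ 2 / 6 + eps / 2) * (v i j - w i j) ^+ 2) =
   h ^+ 2 * \sum_(i < M) \sum_(j < M) (opl M h v i j * opl M h d i j +
    (fnl g eps (v i j) * (v i j - w i j)
    + (g ^+ 2 / 6 + eps / 2) * (v i j - w i j) ^+ 2)).
  transitivity (ip M h (opl M h v) (opl M h d) + h ^+ 2 * \sum_(i < M) \sum_(j < M)
    (fnl g eps (v i j) * (v i j - w i j)
    + (g ^+ 2 / 6 + eps / 2) * (v i j - w i j) ^+ 2)).
    rewrite -sa ipE -mulrDr -big_split; congr (_ * _); apply: eq_bigr => i _.
    rewrite -big_split; apply: eq_bigr => j _; rewrite /chem /d/=; ring.
  rewrite ipE -mulrDr -big_split; congr (_ * _); apply: eq_bigr => i _.
  by rewrite -big_split.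
have enE z : energy g eps M h z = h ^+ 2 * \sum_(i < M) \sum_(j < M)
   (2^-1 * opl M h z i j ^+ 2 +
   (4^-1 * z i j ^+ 4 - g / 3 * (z i j ^+ 2 * z i j) - eps / 2 * (z i j * z i j))).
  rewrite /energy /nrm2 /nrm4_4 !ipE.
  rewrite ![_ * (h ^+ 2 * _)]mulrCA -mulrDr -!mulrBr; congr (_ * _).
  rewrite !big_distrr/= -!sumrN -!big_split; apply: eq_bigr => i _.
  rewrite !big_distrr/= -!sumrN -!big_split; apply: eq_bigr => j _/=.
  by rewrite expr2; ring.
rewrite !enE -mulrBr ler_wpM2l ?sqr_ge0// -sumrB; apply: ler_sum => i _.
rewrite -sumrB; apply: ler_sum => j _.
have := potential_convexity g eps (v i j) (w i j).
rewrite Ld.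
set A := opl M h v i j; set B := opl M h w i j.
have := sqr_ge0 (A - B); nra.
Qed.

End Energy.

(** * The recursion of the complementary kernels *)

Section Pkern.
Variables (R : realType) (alpha : R) (t : nat -> R).

Lemma size_pseq n m : size (pseq alpha t n m) = m.+1.
Proof. by elim: m => //= m IHm; rewrite size_rcons IHm. Qed.

(** Each list only extends the previous one on the right, so an entry does not depend on how far the
    computation was carried. *)
Lemma nth_pseq n m i : (i <= m)%N ->
  nth 0 (pseq alpha t n m) i = pkern alpha t n i.
Proof.
elim: m => [|m IHm]; first by rewrite leqn0 => /eqP ->.
rewrite leq_eqVlt => /predU1P[->//|im].
by rewrite /= nth_rcons size_pseq im IHm.
Qed.

Lemma pkern_rec n k : (1 <= k < n)%N ->
  pkern alpha t n (n - k) = (akern alpha t k k)^-1 *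
    \sum_(k.+1 <= j < n.+1)
       (akern alpha t j k.+1 - akern alpha t j k) * pkern alpha t n (n - j).
Proof.
move=> kn; have E : (n - k = (n - k).-1.+1)%N by lia.
rewrite {1}E /pkern /= nth_rcons size_pseq ltnn eqxx -E subKn; last lia.
congr (_ * _); apply: eq_big_nat => j jn.
by rewrite nth_pseq//; lia.
Qed.

End Pkern.

(** * Integration through explicit primitives *)

Section Integrals.
Local Open Scope classical_set_scope.
Variable R : realType.
Notation mu := (@lebesgue_measure R).

(** Differentiability on the closed interval supplies the continuity of [f] and the one-sided limits
    of [F] at the endpoints. *)
Lemma FTC2_is_derive (f F : R -> R) (a b : R) : a < b ->
  (forall x, a <= x <= b -> derivable f x 1) ->
  (forall x, a <= x <= b -> is_derive x 1 F (f x)) ->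
  (\int[mu]_(x in `[a, b]) (f x)%:E = (F b - F a)%:E)%E.
Proof.
move=> ab df dF.
have cF x : a <= x <= b -> F @ x --> F x.
  move=> /dF[dFx _].
  by apply: differentiable_continuous; exact/derivable1_diffP.
rewrite (@continuous_FTC2 _ f F)//.
- apply: derivable_within_continuous => x; rewrite in_itv/=; exact: df.
- split.
  + move=> x; rewrite in_itv/= => /andP[ax xb].
    by have [] : is_derive x 1 F (f x) by apply: dF; rewrite !ltW.
  + by apply: cvg_at_right_filter; apply: cF; rewrite lexx ltW.
  + by apply: cvg_at_left_filter; apply: cF; rewrite lexx ltW.
- move=> x; rewrite in_itv/= => /andP[ax xb].
  have [_ <-] : is_derive x 1 F (f x) by apply: dF; rewrite !ltW.
  by rewrite derive1E.
Qed.

Lemma is_derive_powR_sub (c p x : R) : x < c ->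
  is_derive x 1 (fun s => (c - s) `^ p) (- (p * (c - x) `^ (p - 1))).
Proof.
move=> xc.
have cx : 0 < c - x by rewrite subr_gt0.
have H1 := @is_derive1_powR R p (c - x) cx.
have H2 : is_derive x 1 (fun s : R => c - s) (-1).
  have H := @is_deriveB _ _ _ _ _ x 1 _ _ (is_derive_cst c x 1) (is_derive_id x 1).
  by apply: is_derive_eq H _; rewrite sub0r.
have := @is_derive1_comp R (fun y => @powR R y p) (fun s => c - s) x _ _ H1 H2.
by rewrite mulrN1.
Qed.

End Integrals.

(** * The Gamma function: finiteness, positivity and the recurrence inequality *)

Section GammaFun.
Local Open Scope classical_set_scope.
Variable R : realType.
Notation mu := (@lebesgue_measure R).
Variable p : R.
Hypothesis p01 : 0 < p < 1.

Let phi (q : R) := fun x : R => x `^ q * expR (- x).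

Lemma measurable_gamma_integrand q (D : set R) : measurable_fun D (phi q).
Proof.
apply: measurable_funTS; apply: measurable_funM => //.
by apply: measurableT_comp => //; exact: measurableT_comp.
Qed.

(** From [x ^ p <= 1 + x <= 2 * (1 + x / 2) <= 2 * expR (x / 2)]. The bound is 4 times the
    exponential density of rate 1/2, which gives integrability below. *)
Lemma gamma_integrand_le x : 0 < x -> phi p x <= 2 * expR (- (x / 2)).
Proof.
move=> x0; rewrite /phi.
have xp : x `^ p <= 1 + x.
  have [x1|/ltW x1] := leP x 1.
    apply: (@le_trans _ _ (1 `^ p)); last by rewrite powR1 lerDl ltW.
    by apply: ge0_ler_powR; rewrite ?nnegrE// ltW//; case/andP: p01.
  apply: (@le_trans _ _ x); last by rewrite lerDr.
  by apply: ler1_powR => //; case/andP: p01 => _ /ltW.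
have -> : - x = - (x / 2) + - (x / 2) by field.
rewrite expRD mulrA ler_wpM2r ?expR_ge0//.
have e := expR_ge1Dx (x / 2).
rewrite expRN ler_pdivrMr ?expR_gt0//.
by apply: le_trans xp _; lra.
Qed.

Lemma gamma_integrable : mu.-integrable `]0, +oo[ (EFin \o phi p).
Proof.
have h0 : 0 < (2^-1 : R) by [].
have Ipdf : mu.-integrable `]0, +oo[ (EFin \o exponential_pdf 2^-1).
  by apply: (@integrableS _ _ _ _ setT) => //; exact: integrable_exponential_pdf.
have I4 : mu.-integrable `]0, +oo[ (fun x => 4%:E * (exponential_pdf 2^-1 x)%:E)%E.
  exact: integrableZl.
apply: le_integrable I4 => //.
  by apply/measurable_EFinP; exact: measurable_gamma_integrand.
move=> x /=; rewrite in_itv/= andbT => x0.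
rewrite exponential_pdfE ?(ltW x0)// lee_fin.
rewrite !ger0_norm ?mulr_ge0 ?powR_ge0 ?expR_ge0//.
apply: le_trans (gamma_integrand_le x x0) _.
by rewrite mulrA (_ : - 2^-1 * x = - (x / 2)); [rewrite ler_wpM2r ?expR_ge0//; lra|field].
Qed.

(** Truncations away from 0 and infinity; the offset 2 keeps the interval nondegenerate at
    [n = 0]. *)
Let E (n : nat) : set (measurableTypeR R) := `[n.+2%:R^-1, n.+2%:R].

Lemma gamma_truncation_cover : \bigcup_n E n = `]0, +oo[.
Proof.
apply/seteqP; split => x /=.
  move=> [n _]; rewrite /E/= !in_itv/= andbT => /andP[+ _].
  by apply: lt_le_trans; rewrite invr_gt0.
rewrite in_itv/= andbT => x0.
pose n := maxn (Num.truncn x) (Num.truncn x^-1).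
exists n => //; rewrite /E/= in_itv/=.
have H (y : R) : 0 < y -> (Num.truncn y <= n)%N -> y <= n.+2%:R.
  move=> y0; rewrite truncn_le_nat => yn; apply/ltW/(lt_le_trans yn).
  by rewrite ler_nat.
rewrite H ?leq_maxl// andbT -[leRHS]invrK lef_pV2 ?posrE ?invr_gt0//.
by rewrite H ?invr_gt0 ?leq_maxr.
Qed.

Lemma gamma_truncation_mono : nondecreasing_seq E.
Proof.
move=> m n mn; apply/subsetPset => x /=; rewrite /E/= !in_itv/= => /andP[a b].
have mn2 : m.+2%:R <= n.+2%:R :> R by rewrite ler_nat.
rewrite (le_trans b)// andbT; apply: le_trans a.
by rewrite lef_pV2 ?posrE.
Qed.

(** Integration by parts: [phi p] has derivative [p * phi (p - 1) - phi p]. The boundary term at the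
    left end has a favourable sign, and the one at the right end is [O(1/n)]. *)
Lemma gamma_truncation_le n :
  (\int[mu]_(x in E n) (phi (p - 1) x)%:E <=
    (p^-1 * (Gamma (p + 1) + 4 * harmonic n))%:E)%E.
Proof.
have nS : n.+1%:R / 2 <= 1 + n.+2%:R / 2 :> R.
  by rewrite -[n.+2%:R]natr1; lra.
have [p0 p1] := andP p01.
have En : (n.+2%:R^-1 : R) < n.+2%:R.
  by rewrite (@lt_trans _ _ 1) ?invf_lt1 ?ltr1n.
have E0 (x : R) : n.+2%:R^-1 <= x <= n.+2%:R -> 0 < x.
  by move=> /andP[+ _]; apply: lt_le_trans; rewrite invr_gt0.
have dphi (q x : R) : 0 < x -> is_derive x 1 (phi q) (q * phi (q - 1) x - phi q x).
  move=> x0; have H1 := @is_derive1_powR R q x x0.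
  have H2 : is_derive x 1 (fun x : R => expR (- x)) (- expR (- x)).
    have H3 := @is_derive1_comp R expR -%R x _ _ (is_derive_expR _) (is_deriveNid _ _).
    by apply: is_derive_eq H3 _; rewrite mulrN1.
  have := @is_deriveM _ _ _ _ _ _ _ _ H1 H2.
  move/is_derive_eq; apply; rewrite /phi/= /GRing.scale/=; ring.
have dphi' (q x : R) : 0 < x -> derivable (phi q) x 1 by move=> /(dphi q)[].
have iphi (q : R) : mu.-integrable (E n) (EFin \o phi q).
  apply: continuous_compact_integrable; first exact: segment_compact.
  by apply: derivable_within_continuous => x; rewrite in_itv/= => /E0; exact: dphi'.
have H := @FTC2_is_derive R (fun x => p * phi (p - 1) x - phi p x) (phi p) _ _ En.
have {}H : \int[mu]_(x in E n) (p * phi (p - 1) x - phi p x) =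
    phi p n.+2%:R - phi p n.+2%:R^-1.
  rewrite -[RHS]/(fine (_%:E)); congr fine.
  apply: H => x /E0 x0; last exact: dphi.
  apply: derivableB => //; last exact: dphi'.
  by apply: derivableM => //; exact: dphi'.
have mE : measurable (E n) by exact: measurable_itv.
move: H; rewrite RintegralB//; last exact: (integrableZl mE p (iphi (p - 1))).
rewrite RintegralZl// => H.
have le1 : \int[mu]_(x in E n) (phi p x) <= Gamma (p + 1).
  rewrite /Gamma addrK; apply: fine_le.
  - by apply: integrable_fin_num => //; exact: iphi.
  - by apply: integrable_fin_num => //; exact: gamma_integrable.
  - apply: ge0_subset_integral => //.
    + by apply/measurable_EFinP; exact: measurable_gamma_integrand.
    + by move=> x _; rewrite lee_fin mulr_ge0 ?powR_ge0 ?expR_ge0.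
    + by rewrite -gamma_truncation_cover; exact: bigcup_sup.
(* The constant 4 comes from [expR y >= 1 + y >= n.+1 / 2] at [y = n.+2 / 2]. *)
have le2 : phi p n.+2%:R <= 4 * harmonic n.
  apply: le_trans (gamma_integrand_le _ _) _; first by [].
  rewrite /= expRN.
  have e := expR_ge1Dx (n.+2%:R / 2 : R).
  apply: (@le_trans _ _ (2 * (n.+1%:R / 2)^-1)); last first.
    by rewrite invf_div mulrA -natrM.
  rewrite ler_wpM2l// lef_pV2 ?posrE ?expR_gt0 ?divr_gt0//.
  exact: le_trans nS e.
have le3 : 0 <= phi p n.+2%:R^-1 by rewrite mulr_ge0 ?powR_ge0 ?expR_ge0.
rewrite -(fineK (integrable_fin_num mE (iphi (p - 1)))) lee_fin.
rewrite mulrC ler_pdivlMr// mulrC.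
move: H le1 le2 le3; rewrite /Rintegral/=.
move: (fine _) (fine _) (phi _ _) (phi _ _) (n.+1%:R^-1) (Gamma _) => A B C D F G.
by clear; lra.
Qed.

(** Monotone limit of the truncated bounds. It is stated in the extended reals because it also
    proves that the integral behind [Gamma p] is finite; [fine] would send an infinite one to 0. *)
Lemma gamma_integral_le :
  (\int[mu]_(x in `]0%R, +oo[) (phi (p - 1) x)%:E <= (p^-1 * Gamma (p + 1))%:E)%E.
Proof.
rewrite -gamma_truncation_cover.
have cI : (\int[mu]_(x in E n) (phi (p - 1) x)%:E)%E @[n --> \oo] -->
    (\int[mu]_(x in \bigcup_n E n) (phi (p - 1) x)%:E)%E.
  apply: ge0_nondecreasing_set_cvg_integral.
  - exact: gamma_truncation_mono.
  - by move=> n; exact: measurable_itv.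
  - by move=> n; apply/measurable_EFinP; exact: measurable_gamma_integrand.
  - by move=> n x _; rewrite lee_fin mulr_ge0 ?powR_ge0 ?expR_ge0.
have cB : ((p^-1 * (Gamma (p + 1) + 4 * harmonic n))%:E : \bar R) @[n --> \oo] -->
   (p^-1 * Gamma (p + 1))%:E.
  apply: cvg_EFin; first exact: nearW.
  rewrite -[X in _ --> p^-1 * X]addr0; apply: cvgMr.
  apply: cvgD; first exact: cvg_cst.
  by rewrite -[X in _ --> X](mulr0 4); apply: cvgMr; exact: cvg_harmonic.
apply: (lee_cvg_to cI cB).
by apply: nearW => n; exact: gamma_truncation_le.
Qed.

Lemma Gamma_le_recurrence : p * Gamma p <= Gamma (p + 1).
Proof.
have [p0 _] := andP p01; rewrite mulrC -ler_pdivlMr// mulrC.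
rewrite -[leRHS]/(fine (_%:E)); apply: fine_le (gamma_integral_le) => //.
apply/fin_numPlt/andP; split; last exact: le_lt_trans gamma_integral_le (ltry _).
apply: lt_le_trans (ltNye_eq 0%:E) _.
by apply: integral_ge0 => x _; rewrite lee_fin mulr_ge0 ?powR_ge0 ?expR_ge0.
Qed.

Lemma Gamma_gt0 : 0 < Gamma p.
Proof.
apply: fine_gt0; apply/andP; split; last first.
  exact: le_lt_trans gamma_integral_le (ltry _).
have [p0 p1] := andP p01.
have phi_ge0 x : (0%E <= (phi (p - 1) x)%:E)%E.
  by rewrite lee_fin mulr_ge0 ?powR_ge0 ?expR_ge0.
(* Both factors of the integrand decrease, so its minimum on [[1, 2]] is its value at 2. *)
pose c := 2 `^ (p - 1) * expR (- 2).
have c0 : 0 < c by rewrite mulr_gt0 ?powR_gt0 ?expR_gt0.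
have I12 : (\int[mu]_(x in `[1%R, 2%R]) c%:E = c%:E)%E.
  rewrite integral_cst//= lebesgue_measure_itv/= lte_fin ltr1n.
  by rewrite -EFinB -EFinM; congr (_%:E); ring.
have le1 : (\int[mu]_(x in `[1%R, 2%R]) c%:E <=
            \int[mu]_(x in `[1%R, 2%R]) (phi (p - 1) x)%:E)%E.
  apply: ge0_le_integral => //=.
  - by move=> x _; rewrite lee_fin ltW.
  - by apply/measurable_EFinP; exact: measurable_gamma_integrand.
  - move=> x; rewrite in_itv/= => /andP[x1 x2]; rewrite lee_fin.
    apply: ler_pM; rewrite ?powR_ge0 ?expR_ge0//; last by rewrite ler_expR lerN2.
    rewrite -[p - 1]opprB !powRN lef_pV2 ?posrE ?powR_gt0 ?(lt_le_trans ltr01 x1)//.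
    by apply: ge0_ler_powR; rewrite ?nnegrE//; lra.
have le2 : (\int[mu]_(x in `[1%R, 2%R]) (phi (p - 1) x)%:E <=
            \int[mu]_(x in `]0%R, +oo[) (phi (p - 1) x)%:E)%E.
  apply: ge0_subset_integral => //.
  - by apply/measurable_EFinP; exact: measurable_gamma_integrand.
  - move=> x /=; rewrite !in_itv/= andbT => /andP[x1 _].
    exact: lt_le_trans ltr01 x1.
by apply: lt_le_trans (le_trans le1 le2); rewrite I12 lte_fin.
Qed.

End GammaFun.

(** * Integrals of the weakly singular kernel: monotonicity and ratios *)

Section KernelIntegral.
Local Open Scope classical_set_scope.
Variable R : realType.
Notation mu := (@lebesgue_measure R).
Variable p : R.
Hypothesis p01 : 0 < p < 1.

Lemma omega_gt0 (x : R) : 0 < x -> 0 < omega p x.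
Proof. by move=> x0; rewrite divr_gt0 ?powR_gt0 ?Gamma_gt0. Qed.

Lemma omega_ge0 (x : R) : 0 <= omega p x.
Proof. by rewrite divr_ge0 ?powR_ge0 ?ltW ?Gamma_gt0. Qed.

Lemma omega_anti (x y : R) : 0 < x -> x <= y -> omega p y <= omega p x.
Proof.
have [p0 p1] := andP p01.
move=> x0 xy; have G0 := ltW (Gamma_gt0 R p p01).
rewrite ler_wpM2r ?invr_ge0//.
rewrite -[p - 1]opprB !powRN lef_pV2 ?posrE ?powR_gt0 ?(lt_le_trans x0)//.
by apply: ge0_ler_powR; rewrite ?nnegrE//; lra.
Qed.

(** A product of two values of the power depends only on the product of the arguments, and the
    exponent [p - 1] is negative. *)
Lemma omega_log_convex (x y z w : R) :
  0 < x -> 0 < y -> 0 < z -> 0 < w -> x * y <= z * w ->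
  omega p z * omega p w <= omega p x * omega p y.
Proof.
have [p0 p1] := andP p01.
move=> x0 y0 z0 w0 xyzw; have G0 := ltW (Gamma_gt0 R p p01).
rewrite /omega mulrACA [leRHS]mulrACA ler_wpM2r ?mulr_ge0 ?invr_ge0//.
have powM (s r : R) : 0 < s -> 0 < r ->
    s `^ (p - 1) * r `^ (p - 1) = (s * r) `^ (p - 1).
  by move=> s0 r0; rewrite powRM ?ltW.
rewrite !powM// -[p - 1]opprB !powRN lef_pV2 ?posrE ?powR_gt0 ?mulr_gt0//.
by apply: ge0_ler_powR; rewrite ?nnegrE ?mulr_ge0 ?subr_ge0// ltW.
Qed.

Definition omega_int (T a b : R) : R :=
  \int[mu]_(s in `[a, b]) omega p (T - s).

Lemma measurable_omega_sub (T : R) (D : set R) :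
  measurable_fun D (fun s => omega p (T - s)).
Proof.
apply: measurable_funTS; apply: measurable_funM => //.
apply: (measurableT_comp (measurable_powR _)); exact: measurable_funB.
Qed.

Let E (a b : R) (n : nat) : set (measurableTypeR R) :=
  `[a, b - (b - a) / n.+2%:R].

Lemma omega_truncation_cover (a b : R) : a < b ->
  \bigcup_n E a b n = `[a, b[.
Proof.
move=> ab; have ab0 : 0 < b - a by rewrite subr_gt0.
apply/seteqP; split => x /=.
  move=> [n _]; rewrite /E/= !in_itv/= => /andP[-> xb]/=.
  by apply: le_lt_trans xb _; rewrite ltrBlDr ltrDl divr_gt0.
rewrite in_itv/= => /andP[ax xb].
have bx : 0 < b - x by rewrite subr_gt0.
exists (Num.truncn ((b - a) / (b - x))) => //; rewrite /E/= in_itv/= ax/=.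
rewrite lerBrDr -lerBrDl ler_pdivrMr// -ler_pdivrMl// mulrC.
set n := Num.truncn _.
have : (n <= n)%N by [].
rewrite {1}/n truncn_le_nat => /ltW/le_trans; apply.
by rewrite ler_nat.
Qed.

(** An improper integral: the primitive [- K * (b - s) ^ p] is evaluated on intervals that stop
    short of the singularity at [b], followed by a monotone limit. *)
Lemma omega_diag (a b : R) : a < b ->
  (\int[mu]_(s in `[a, b]) (omega p (b - s))%:E =
    ((b - a) `^ p / (p * Gamma p))%:E)%E.
Proof.
have [p0 p1] := andP p01.
have G0 := Gamma_gt0 R p p01.
move=> ab; have ab0 : 0 < b - a by rewrite subr_gt0.
pose K := (p * Gamma p)^-1.
rewrite -integral_itv_bndo_bndc; last first.
  by apply/measurable_EFinP; exact: measurable_omega_sub.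
rewrite -omega_truncation_cover//.
have cI : (\int[mu]_(s in E a b n) (omega p (b - s))%:E)%E @[n --> \oo] -->
    (\int[mu]_(s in \bigcup_n E a b n) (omega p (b - s))%:E)%E.
  apply: ge0_nondecreasing_set_cvg_integral.
  - move=> m n mn; apply/subsetPset => x /=; rewrite /E/= !in_itv/= => /andP[-> xb]/=.
    apply: le_trans xb _; rewrite lerD2l lerN2 ler_pM2l//.
    by rewrite lef_pV2 ?posrE// ler_nat.
  - by move=> n; exact: measurable_itv.
  - by move=> n; apply/measurable_EFinP; exact: measurable_omega_sub.
  - by move=> n x _; rewrite lee_fin omega_ge0.
have In n : (\int[mu]_(s in E a b n) (omega p (b - s))%:E =
    (K * ((b - a) `^ p - ((b - a) / n.+2%:R) `^ p))%:E)%E.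
  have d0 : 0 < (b - a) / n.+2%:R by rewrite divr_gt0.
  have d1 : (b - a) / n.+2%:R < b - a.
    by rewrite ltr_pdivrMr// ltr_pMr// ltr1n.
  have sb (s : R) : a <= s <= b - (b - a) / n.+2%:R -> s < b.
    by move=> /andP[_ /le_lt_trans]; apply; rewrite ltrBlDr ltrDl.
  have dw (q c s : R) : s < b -> is_derive s 1 (fun x => c * (b - x) `^ q)
      (c * - (q * (b - s) `^ (q - 1))).
    move=> sb'; have H := is_derive_powR_sub R b q s sb'.
    exact: (@is_deriveZ _ _ _ _ c s 1 _ H).
  pose F (x : R) := - K * (b - x) `^ p.
  transitivity ((F (b - (b - a) / n.+2%:R) - F a)%:E); last first.
    by congr (_%:E); rewrite /F opprB addrCA subrr addr0; ring.
  apply: (@FTC2_is_derive R _ F).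
  - by rewrite ltrBrDl -ltrBrDr.
  - move=> s /sb {}sb; have [+ _] := dw (p - 1) (Gamma p)^-1 s sb.
    by under eq_fun do rewrite mulrC.
  - move=> s /sb {}sb; apply: is_derive_eq (dw p (- K) s sb) _.
    by rewrite /omega /K; field; rewrite !gt_eqF.
have cF : ((K * ((b - a) `^ p - ((b - a) / n.+2%:R) `^ p))%:E : \bar R) @[n --> \oo] -->
    ((b - a) `^ p / (p * Gamma p))%:E.
  apply: cvg_EFin; first exact: nearW.
  rewrite mulrC -/K -[X in _ --> K * X]subr0; apply: cvgMr; apply: cvgB; first exact: cvg_cst.
  have H0 : ((b - a) / n.+2%:R : R) @[n --> \oo] --> (0 : R).
    rewrite -[X in _ --> X](mulr0 (b - a)); apply: cvgMr.
    have := @cvg_harmonic R; rewrite -(cvg_shiftS _).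
    by [].
  (* The gaps tend to 0 through positive values, so the right limit of the power at 0 applies. *)
  apply: (cvg_at_rightP (fun x : R => x `^ p) 0 0).1 (powR_cvg0 p0) _ _.
  by split => [n|//]; rewrite divr_gt0.
have cI' : (K * ((b - a) `^ p - ((b - a) / n.+2%:R) `^ p))%:E @[n --> \oo] -->
    (\int[mu]_(s in \bigcup_n E a b n) (omega p (b - s))%:E)%E.
  by under eq_fun do rewrite -In.
exact: (cvg_unique _ cI' cF).
Qed.

(** The ratio of [omega p (T - s)] to [omega p (T' - s)] increases with [s]: the two products of
    arguments differ by [(T' - T) * (b - s)]. *)
Lemma omega_cross (T T' s b : R) : s <= b -> b < T -> T <= T' ->
  omega p (T - s) * omega p (T' - b) <= omega p (T' - s) * omega p (T - b).
Proof.
move=> sb bT TT'; have bT' := lt_le_trans bT TT'.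
rewrite omega_log_convex ?subr_gt0 ?(le_lt_trans sb)// -subr_ge0.
rewrite [leRHS](_ : _ = (T' - T) * (b - s)); last by ring.
by rewrite mulr_ge0 ?subr_ge0.
Qed.

(** If [b = T] the singularity is an endpoint and [omega_diag] gives finiteness; if [b < T] the
    integrand is continuous. *)
Lemma omega_integrable (T a b : R) : a < b -> b <= T ->
  mu.-integrable `[a, b] (EFin \o (fun s => omega p (T - s))).
Proof.
move=> ab; rewrite le_eqVlt => /predU1P[<-|bT].
  apply/integrableP; split.
    by apply/measurable_EFinP; exact: measurable_omega_sub.
  rewrite [ltLHS](_ : _ = (\int[mu]_(s in `[a, b]) (omega p (b - s))%:E)%E).
    by rewrite omega_diag// ltry.
  by apply: eq_integral => s _; rewrite /= ger0_norm ?omega_ge0.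
apply: continuous_compact_integrable; first exact: segment_compact.
apply: derivable_within_continuous => x; rewrite in_itv/= => /andP[_ xb].
apply: derivableM => //.
by have [] := is_derive_powR_sub R T (p - 1) x (le_lt_trans xb bT).
Qed.

(* The comparison is only required on [[a, b[[ because at [s = b = T] the
   integrand takes the junk value [omega p 0 = 0]. *)
Lemma le_omega_int (c d T T' a b : R) : a < b -> b <= T -> b <= T' ->
  (forall s, a <= s < b -> c * omega p (T - s) <= d * omega p (T' - s)) ->
  c * omega_int T a b <= d * omega_int T' a b.
Proof.
move=> ab bT bT' H.
have I U : b <= U -> mu.-integrable `[a, b[ (EFin \o (fun s => omega p (U - s))).
  move=> bU; apply: integrableS (omega_integrable U a b ab bU) => //.
  by apply: subset_itvl; rewrite bnd_simp.
have IZ e U : b <= U ->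
    mu.-integrable `[a, b[ (EFin \o (fun s => e * omega p (U - s))).
  by move=> bU; apply: (integrableZl _ e (I U bU)).
rewrite /omega_int -!Rintegral_itv_bndo_bndc; try exact: I.
rewrite -!RintegralZl//; try exact: I.
apply: le_Rintegral; try exact: IZ; first by [].
by move=> s; rewrite /= in_itv/=; exact: H.
Qed.

Lemma omega_int_anti (T T' a b : R) : a < b -> b <= T -> T <= T' ->
  omega_int T' a b <= omega_int T a b.
Proof.
move=> ab bT TT'; rewrite -[leLHS]mul1r -[leRHS]mul1r.
apply: le_omega_int => //; first exact: le_trans bT TT'.
by move=> s /andP[_ sb]; rewrite !mul1r omega_anti ?lerD2r ?subr_gt0 ?(lt_le_trans sb).
Qed.

Lemma omega_int_gt0 (T a b : R) : a < b -> b <= T -> 0 < omega_int T a b.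
Proof.
move=> ab bT.
(* On [[a, b[] the integrand is at least its value at [a]; the half-open interval excludes the
   default value 0 at [s = b = T]. *)
apply: (@lt_le_trans _ _ (\int[mu]_(s in `[a, b[) omega p (T - a))).
  rewrite Rintegral_cst//= lebesgue_measure_itv/= lte_fin ab -EFinB/=.
  by rewrite mulr_gt0 ?subr_gt0// omega_gt0 ?subr_gt0 ?(lt_le_trans ab).
have I : mu.-integrable `[a, b[ (EFin \o (fun s => omega p (T - s))).
  apply: integrableS (omega_integrable T a b ab bT) => //.
  by apply: subset_itvl; rewrite bnd_simp.
rewrite /omega_int -Rintegral_itv_bndo_bndc//.
apply: le_Rintegral => //.
  apply: integrableS (_ : mu.-integrable `[a, b] _) => //.
    by apply: subset_itvl; rewrite bnd_simp.
  apply: continuous_compact_integrable; first exact: segment_compact.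
  by apply: derivable_within_continuous => x _; exact: derivable_cst.
move=> s; rewrite /= in_itv/= => /andP[sa sb].
by rewrite omega_anti ?lerD2l ?lerN2 ?subr_gt0 ?(lt_le_trans sb).
Qed.

(* Both integrals are compared with the value of the kernel at the shared
   endpoint [b]. *)
Lemma omega_int_ratio (T T' a b c : R) :
  a < b -> b < c -> c <= T -> T <= T' ->
  omega_int T a b * omega_int T' b c <= omega_int T' a b * omega_int T b c.
Proof.
move=> ab bc cT TT'.
have cT' := le_trans cT TT'; have bT := lt_le_trans bc cT.
have bT' := lt_le_trans bc cT'.
have A : omega p (T' - b) * omega_int T a b <= omega p (T - b) * omega_int T' a b.
  apply: (le_omega_int _ _ _ _ _ _ ab (ltW bT) (ltW bT')) => s /andP[sa sb].
  by rewrite mulrC [leRHS]mulrC omega_cross// ltW.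
have B : omega p (T - b) * omega_int T' b c <= omega p (T' - b) * omega_int T b c.
  apply: (le_omega_int _ _ _ _ _ _ bc cT' cT) => s /andP[sb sc].
  by apply: omega_cross => //; exact: lt_le_trans sc cT.
have w0 : 0 < omega p (T' - b) by rewrite omega_gt0 ?subr_gt0.
have w1 : 0 < omega p (T - b) by rewrite omega_gt0 ?subr_gt0.
have I1 := omega_int_gt0 T a b ab (ltW bT).
have I2 := omega_int_gt0 T' b c bc cT'.
move: (omega p (T' - b)) (omega p (T - b)) (omega_int T a b) (omega_int T' b c)
  (omega_int T' a b) (omega_int T b c) A B w0 w1 I1 I2.
move=> x y i j i' j' A B x0 y0 i0 j0.
(* Multiply [A] by [B]; the factors at the shared endpoint cancel. *)
rewrite -(ler_pM2l (mulr_gt0 x0 y0)) mulrACA [leRHS](_ : _ = y * i' * (x * j')).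
  by apply: ler_pM => //; rewrite mulr_ge0 ?ltW.
by ring.
Qed.

End KernelIntegral.

(** * Positivity, monotonicity, ratio and diagonal bounds of the L1 kernels *)

Section L1Kernel.
Variables (R : realType) (alpha : R) (t : nat -> R) (N : nat).
Hypothesis alpha01 : 0 < alpha < 1.
Hypothesis t_incr : forall k, (1 <= k <= N)%N -> t k.-1 < t k.

Let p01 : 0 < 1 - alpha < 1.
Proof. by move: alpha01 => /andP[a0 a1]; apply/andP; split; lra. Qed.

Lemma grid_le j n : (j <= n <= N)%N -> t j <= t n.
Proof.
elim: n => [|n IHn]; first by rewrite leqn0 => /andP[/eqP->].
rewrite leq_eqVlt => /andP[/predU1P[->//|jn] nN].
apply: le_trans (IHn _) (ltW (t_incr n.+1 _)); lia.
Qed.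

Lemma akernE n k : akern alpha t n k =
  (t k - t k.-1)^-1 * omega_int R (1 - alpha) (t n) (t k.-1) (t k).
Proof. by []. Qed.

Let step_gt0 k : (1 <= k <= N)%N -> 0 < (t k - t k.-1)^-1.
Proof. by move=> kN; rewrite invr_gt0 subr_gt0 t_incr. Qed.

Lemma akern_gt0 n k : (1 <= k <= n)%N -> (n <= N)%N -> 0 < akern alpha t n k.
Proof.
move=> kn nN; rewrite akernE mulr_gt0 ?step_gt0 ?omega_int_gt0 ?t_incr ?grid_le//; lia.
Qed.

Lemma akern_anti n j : (1 <= j <= n)%N -> (n <= N)%N ->
  akern alpha t n 1 <= akern alpha t j 1.
Proof.
move=> jn nN; rewrite !akernE ler_pM2l ?step_gt0 ?omega_int_anti ?t_incr ?grid_le//; lia.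
Qed.

(** Both sides carry the same step-size factors, so mesh ratios do not enter and [omega_int_ratio]
    on two adjacent cells decides. *)
Lemma akern_ratio n j k : (1 <= k < j)%N -> (j <= n <= N)%N ->
  akern alpha t j k * akern alpha t n k.+1 <=
  akern alpha t n k * akern alpha t j k.+1.
Proof.
move=> kj jn; rewrite !akernE mulrACA [leRHS]mulrACA ler_pM2l; last first.
  by rewrite mulr_gt0 ?step_gt0//; lia.
apply: omega_int_ratio => //;
  [apply: t_incr|apply: (t_incr k.+1)|apply: grid_le|apply: grid_le]; lia.
Qed.

Lemma akern_diag n : (1 <= n <= N)%N -> akern alpha t n n =
  (t n - t n.-1) `^ (- alpha) / ((1 - alpha) * Gamma (1 - alpha)).
Proof.
move=> nN; have d0 : 0 < t n - t n.-1 by rewrite subr_gt0 t_incr.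
rewrite akernE /omega_int /Rintegral omega_diag ?t_incr//=.
rewrite mulrA; congr (_ / _).
rewrite powRD; last by rewrite (gt_eqF d0) implybT.
by rewrite powRr1 ?ltW// mulKf// gt_eqF.
Qed.

(** The hypothesis says that the step to the power [alpha], times [Gamma (2 - alpha)], is at most
    [c]; [Gamma_le_recurrence] compares this product with the denominator of the diagonal kernel. *)
Lemma akern_diag_ge (c : R) n : 0 < c -> (1 <= n <= N)%N ->
  taumax t N <= (c / Gamma (2 - alpha)) `^ alpha^-1 ->
  c^-1 <= akern alpha t n n.
Proof.
have [a0 a1] := andP alpha01.
move=> c0 nN tau_le; have d0 : 0 < t n - t n.-1 by rewrite subr_gt0 t_incr.
have pG : 0 < (1 - alpha) * Gamma (1 - alpha).
  by rewrite mulr_gt0 ?Gamma_gt0//; case/andP: p01.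
have G2 : (1 - alpha) * Gamma (1 - alpha) <= Gamma (2 - alpha).
  by rewrite [X in _ <= Gamma X](_ : _ = 1 - alpha + 1); [exact: Gamma_le_recurrence|ring].
have G0 := lt_le_trans pG G2.
have tn : t n - t n.-1 <= taumax t N.
  rewrite /taumax.
  apply: (@le_bigmax_seq _ _ _ (index_iota 1 N.+1) 0 n xpredT (fun k => t k - t k.-1)) => //.
  by rewrite mem_index_iota ltnS.
have : (t n - t n.-1) `^ alpha <= c / Gamma (2 - alpha).
  have -> : c / Gamma (2 - alpha) = ((c / Gamma (2 - alpha)) `^ alpha^-1) `^ alpha.
    by rewrite -powRrM mulVf ?gt_eqF// powRr1// divr_ge0 ?ltW.
  apply: ge0_ler_powR; rewrite ?nnegrE ?powR_ge0//; try exact: ltW.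
  exact: le_trans tn tau_le.
rewrite akern_diag//; move: (Gamma (2 - alpha)) (_ * Gamma _) pG G2 G0 => x y y0 yx x0 H.
rewrite powRN -invfM lef_pV2 ?posrE ?mulr_gt0 ?powR_gt0//.
rewrite -ler_pdivlMr//; apply: le_trans H _.
by rewrite ler_pM2l// lef_pV2.
Qed.

End L1Kernel.

(** * Assembly of the energy law *)

Theorem theorem3p1 (R : realType) (alpha g eps L T h : R) (M N : nat)
    (t : nat -> R) (u0 : R -> R -> R) (u : nat -> nat -> nat -> R) :
  0 < alpha < 1 -> 0 <= g -> 0 < eps ->
  0 < L -> (0 < M)%N -> h = L / M%:R ->
  t 0%N = 0 -> (forall k, (1 <= k <= N)%N -> t k.-1 < t k) -> t N = T ->
  (forall i j, (i < M)%N -> (j < M)%N -> u 0%N i j = u0 (i%:R * h) (j%:R * h)) ->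
  (forall n i j, (1 <= n <= N)%N -> (i < M)%N -> (j < M)%N ->
     Dalpha alpha t u n i j = - chem g eps M h (u n) i j) ->
  taumax t N <= powR (3 / (Gamma (2 - alpha) * (4 * g ^+ 2 + 3 * eps))) alpha^-1 ->
  forall n, (1 <= n <= N)%N ->
    menergy alpha g eps t M h u n - menergy alpha g eps t M h u n.-1 <= 0.
Proof.
move=> alpha01 g0 eps0 _ _ _ _ t_incr _ _ scheme tau_le n nN.
pose a := akern alpha t; pose P m j := pkern alpha t m (m - j).
have [n_gt0 nleN] := andP nN.
have prednK : n.-1.+1 = n by rewrite prednK.
have a_gt0 m k : (1 <= k <= m)%N -> (m <= N)%N -> 0 < a m k.
  exact: (@akern_gt0 R alpha t N alpha01 t_incr m k).
have a_gt0n j k : (1 <= k <= j)%N -> (j <= n)%N -> 0 < a j k.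
  by move=> kj jn; apply: a_gt0 kj (leq_trans jn nleN).
have Pnn m : (1 <= m <= N)%N -> P m m = (a m m)^-1.
  by move=> _; rewrite /P subnn.
have comp m : (1 <= m <= N)%N -> forall k, (1 <= k <= m)%N ->
    \sum_(k <= j < m.+1) P m j * a j k = 1.
  move=> mN; apply: (@complementary_convolution R a (P m)).
    by rewrite Pnn// mulVf// gt_eqF// a_gt0; lia.
  move=> k kn; rewrite /P pkern_rec//.
  by rewrite mulrC mulVKf// gt_eqF// a_gt0; lia.
(* The guard matters at [j = n]: truncated subtraction would turn [P n.-1 n] into the entry
   [pkern alpha t n.-1 0]. *)
pose r j := P n j - (if (j < n)%N then P n.-1 j else 0).
have rn : r n = (a n n)^-1 by rewrite /r ltnn subr0 Pnn.
have rn_gt0 : 0 < r n by rewrite rn invr_gt0 a_gt0; lia.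
have sum_r (F : nat -> R) k : (k <= n)%N -> \sum_(k <= j < n.+1) r j * F j =
    \sum_(k <= j < n.+1) P n j * F j - \sum_(k <= j < n) P n.-1 j * F j.
  move=> kn; rewrite !big_nat_recr//= [r n]/r ltnn subr0 addrAC -sumrB.
  congr (_ + _); apply: eq_big_nat => j jn.
  by rewrite /r (_ : (j < n)%N) ?mulrBl//; lia.
(* The complementary identities at levels [n] and [n.-1] both equal 1 and cancel. *)
have r_orth k : (1 <= k < n)%N -> \sum_(k <= j < n.+1) r j * a j k = 0.
  move=> kn; rewrite (sum_r (a ^~ k)) ?comp; try lia.
  by have := @comp n.-1 _ k _; rewrite prednK => ->; rewrite ?subrr//; lia.
have r_le0 : forall k, (1 <= k < n)%N -> r k <= 0.
  apply: (@orthogonal_kernel_le0 R a r n a_gt0n rn_gt0 r_orth) => j k kj jn.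
  by apply: (@akern_ratio R alpha t N alpha01 t_incr _ _ _ kj); rewrite jn nleN.
have r_sum : 0 <= \sum_(1 <= j < n.+1) r j.
  apply: (@orthogonal_kernel_sum_ge0 R a r n a_gt0n rn_gt0 r_orth n_gt0 r_le0) => j jn.
  exact: (@akern_anti R alpha t N alpha01 t_incr _ _ jn nleN).
pose mu m := chem g eps M h (u m).
pose d m i j := u m i j - u m.-1 i j.
(* Insert the scheme, exchange the triangular sums and collapse the inner one by [comp]: the scheme
   is inverted, up to telescoping of [d]. *)
have conv m i j : (1 <= m <= N)%N -> (i < M)%N -> (j < M)%N ->
    \sum_(1 <= k < m.+1) P m k * mu k i j = - \sum_(1 <= k < m.+1) d k i j.
  move=> mN iM jM.
  transitivity (- \sum_(1 <= k < m.+1) \sum_(1 <= l < k.+1) P m k * a k l * d l i j).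
    rewrite -sumrN; apply: eq_big_nat => k km.
    rewrite -[mu k i j]opprK /mu -scheme//; last by clear -km mN; lia.
    by rewrite mulrN big_distrr/=; congr (- _); apply: eq_bigr => l _; rewrite mulrA.
  congr (- _); rewrite exchange_big_triangle; apply: eq_big_nat => l lm.
  by rewrite -[RHS]mul1r -(comp m mN l) ?big_distrl.
have dE i j : (i < M)%N -> (j < M)%N ->
    d n i j = - \sum_(1 <= k < n.+1) r k * mu k i j.
  move=> iM jM; rewrite (sum_r (fun k => mu k i j)) ?conv; try lia.
  have -> : \sum_(1 <= k < n) P n.-1 k * mu k i j = - \sum_(1 <= k < n) d k i j.
    have [n1|n1] := leqP n 1; first by rewrite !big_geq ?oppr0.
    by have := @conv n.-1 i j; rewrite prednK; apply; lia.
  rewrite big_nat_recr/=; last lia.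
  ring.
have en := @energy_increment_le R M h g eps (u n) (u n.-1).
(* With [c = 3 / (4 * g ^+ 2 + 3 * eps)], half of [c^-1] is [2 * g ^+ 2 / 3 + eps / 2], which
   dominates the left-hand side. *)
have a_ge : g ^+ 2 / 6 + eps / 2 <= a n n / 2.
  have c0 : 0 < 4 * g ^+ 2 + 3 * eps by have := sqr_ge0 g; lra.
  have := @akern_diag_ge R alpha t N alpha01 t_incr (3 / (4 * g ^+ 2 + 3 * eps)) n.
  rewrite divr_gt0// invf_div mulrAC -mulrA -invfM.
  move=> /(_ isT nN tau_le); rewrite -/(a n n).
  by have := sqr_ge0 g; lra.
(* The empty sum covers [m = 0], so [n = 1] needs no separate treatment. *)
have menergyE m : menergy alpha g eps t M h u m = energy g eps M h (u m)
    + 2^-1 * \sum_(1 <= j < m.+1) P m j * nrm2 M h (mu j).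
  by case: m => [|m]//; rewrite big_geq// mulr0 addr0.
rewrite !menergyE prednK opprD addrACA -mulrBr -(sum_r (fun j => nrm2 M h (mu j))); last lia.
have sumE : \sum_(1 <= k < n.+1) r k * nrm2 M h (mu k) =
    h ^+ 2 * \sum_(i < M) \sum_(j < M) \sum_(1 <= k < n.+1) r k * mu k i j ^+ 2.
  under eq_bigr do rewrite /nrm2 /ip mulrCA.
  rewrite -big_distrr/=; congr (_ * _).
  under eq_bigr do rewrite big_distrr/=.
  rewrite exchange_big/=; apply: eq_bigr => i _.
  under eq_bigr do rewrite big_distrr/=.
  by rewrite exchange_big/=.
apply: le_trans (lerD en (lexx _)) _.
rewrite sumE mulrCA -mulrDr mulr_ge0_le0 ?sqr_ge0// big_distrr -big_split/=.
apply: sumr_le0 => i _; rewrite big_distrr -big_split/=.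
apply: sumr_le0 => j _.
(* At each grid point the sum of [r k * mu k] is [- d n] and [(r n)^-1 = a n n]; half of this
   inequality plus [Cd] is the claim. *)
have := @convolution_square_le R r (fun k => mu k i j) n _ rn_gt0 r_le0 r_sum.
have dn := dE i j (ltn_ord i) (ltn_ord j).
rewrite -[\sum_(_ <= _ < _) r _ * mu _ _ _]opprK -dn sqrrN rn invrK.
rewrite -/(mu n i j) -/(d n i j) => /(_ n_gt0) H.
have Cd := ler_wpM2r (sqr_ge0 (d n i j)) a_ge.
move: (\sum_(_ <= _ < _) _) (mu n i j) (d n i j) (a n n) H Cd => S x y z.
clear; lra.
Qed.
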